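(* Let $G$ be a connected semigraph with adjacency matrix $A$ (as defined in the context) and energy $\mathcal{E}(G)$. Suppose $\mathcal{E}(G)$ is a rational number. If $G$ has no middle end vertices, then $\mathcal{E}(G)$ is an even integer; if $G$ has middle end vertices, then $\mathcal{E}(G)=\frac{N}{2^r}$ for some $N\in\mathbb{Z}$ and $r\in\mathbb{N}$.
   Context: A semigraph $G=(V,E)$ has a finite vertex set $V=\{v_1,\dots,v_n\}$, $n\ge2$, and edges that are ordered tuples $(u_1,\dots,u_k)$, $k\ge2$, of distinct vertices, with any two edges sharing at most one vertex, and $(u_1,\dots,u_k)$ identified with $(u_k,\dots,u_1)$. In an edge $(u_1,\dots,u_k)$, $u_1,u_k$ are end vertices and $u_2,\dots,u_{k-1}$ middle vertices. A vertex is a pure end vertex if it is an end vertex of every edge containing it, and a middle end vertex if it is a middle vertex of at least one edge and an end vertex of at least one other edge. An edge $(u_1,\dots,u_k)$ is full if $u_1,u_k$ are pure end vertices; an edge with $k>2$ is a half edge if $u_1$ or $u_k$ is a middle end vertex; an edge $(u_1,u_2)$ is a quarter edge if both $u_1,u_2$ are middle end vertices, and a half edge if exactly one is a middle end vertex. In a half edge $(u_1,\dots,u_k)$, $(u_1,u_2)$ is a partial half edge if $u_1$ is a middle end vertex, and $(u_{k-1},u_k)$ is a partial half edge if $u_k$ is a middle end vertex. $G$ is connected if any two vertices $u,v$ are joined by a sequence of edges $e_{1},\dots,e_{p}$ with $u\in e_1$, $v\in e_p$ and $|e_j\cap e_{j+1}|=1$. For $u_i,u_j$ in an edge $e=(u_1,\dots,u_k)$,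 $d_e(u_i,u_j)=|i-j|$. The adjacency matrix $A=(a_{ij})$ is indexed by vertices: $a_{ij}=d_e(v_i,v_j)$ if $v_i,v_j$ lie in a common full or half edge $e$ and $(v_i,v_j)$ is neither a partial half edge nor a quarter edge; $a_{ij}=\frac12$ if $(v_i,v_j)$ is a partial half edge; $a_{ij}=\frac14$ if $(v_i,v_j)$ is a quarter edge; $a_{ij}=0$ otherwise. $A$ is symmetric; the energy $\mathcal{E}(G)$ is the sum of the absolute values of the eigenvalues of $A$. *)

(* Defs.v *)
From HB Require Import structures.
From mathcomp Require Import all_boot all_order all_algebra.
From mathcomp Require Import reals.
From mathcomp Require Import complex.

Set Implicit Arguments.
Unset Strict Implicit.
Unset Printing Implicit Defensive.

Import Order.TTheory GRing.Theory Num.Theory.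
Local Open Scope ring_scope.

(* The edge set is given by a list of representatives modulo reversal: [e] and
   [rev e] denote the same edge, and listing an edge several times (in either
   direction) has no effect. *)
Definition same_edge (T : eqType) (e f : seq T) : bool :=
  (e == f) || (e == rev f).

Definition common (T : finType) (e f : seq T) : {set T} :=
  [set v | (v \in e) && (v \in f)].

Record semigraph (n : nat) := Semigraph {
  edges : seq (seq 'I_n);
  edge_size : forall e, e \in edges -> (2 <= size e)%N;
  edge_uniq : forall e, e \in edges -> uniq e;
  edge_common : forall e f, e \in edges -> f \in edges ->
    ~~ same_edge e f -> (#|common e f| <= 1)%N
}.

Section Semigraph.
Variables (n : nat) (G : semigraph n).
Implicit Types (e : seq 'I_n) (u v : 'I_n).

(* Positions in an edge are counted from 0 by [index]. *)
Definition end_of e v : bool :=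
  (v \in e) && ((index v e == 0%N) || (index v e == (size e).-1)).

Definition middle_of e v : bool :=
  (v \in e) && (0 < index v e < (size e).-1)%N.

Definition pure_end v : bool :=
  all (fun e => (v \in e) ==> end_of e v) (edges G).

(* The two edges are necessarily distinct, since an edge has no repeated
   vertex. *)
Definition middle_end v : bool :=
  has (fun e => middle_of e v) (edges G) && has (fun e => end_of e v) (edges G).

Definition full_edge e : bool := [forall v, end_of e v ==> pure_end v].

Definition half_edge e : bool :=
  if (2 < size e)%N then [exists v, end_of e v && middle_end v]
  else #|[set v | end_of e v && middle_end v]| == 1%N.

Definition quarter_edge e : bool :=
  (size e == 2%N) && [forall v, end_of e v ==> middle_end v].

Definition edge_dist e u v : nat := `|index u e - index v e|%N.

(* [u] is an end vertex of the half edge [e] that is a middle end vertex, and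
   [v] is the neighbour of [u] in [e]. *)
Definition partial_half_from e u v : bool :=
  [&& half_edge e, end_of e u, middle_end u, v \in e & edge_dist e u v == 1%N].

Definition is_partial_half u v : bool :=
  has (fun e => partial_half_from e u v || partial_half_from e v u) (edges G).

Definition is_quarter u v : bool :=
  has (fun e => [&& quarter_edge e, u \in e, v \in e & u != v]) (edges G).

Definition full_or_half_edges u v : seq (seq 'I_n) :=
  [seq e <- edges G | [&& full_edge e || half_edge e, u \in e & v \in e]].

(* Distinct [u] and [v] lie in at most one common edge up to reversal, and
   [edge_dist e u u = 0], so the choice of the first edge is immaterial. *)
Definition adjacency (R : fieldType) : 'M[R]_n :=
  \matrix_(i, j)
    if is_partial_half i j then 2%:R^-1
    else if is_quarter i j then 4%:R^-1
    else if full_or_half_edges i j is e :: _ then (edge_dist e i j)%:R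
    else 0.

Definition sg_connected : Prop :=
  forall u v, exists e (p : seq (seq 'I_n)),
    [/\ {subset e :: p <= edges G}, u \in e, v \in last e p
      & path (fun e f => #|common e f| == 1%N) e p].

End Semigraph.

(* The complex eigenvalues of [A], listed with algebraic multiplicity. *)
Definition eigenvalues (R : rcfType) (n : nat) (A : 'M[R]_n) : seq R[i] :=
  sval (closed_field_poly_normal (char_poly (map_mx (real_complex R) A))).

Definition energy (R : rcfType) (n : nat) (G : semigraph n) : R :=
  \sum_(z <- eigenvalues (adjacency G R)) complex.Re `|z|.

(* Main.v *)
Require Import Defs.
From HB Require Import structures.
From mathcomp Require Import all_boot all_order all_algebra all_field.
From mathcomp Require Import reals.
From mathcomp Require Import complex.

Set Implicit Arguments.
Unset Strict Implicit.
Unset Printing Implicit Defensive.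

Import Order.TTheory GRing.Theory Num.Theory.
Local Open Scope ring_scope.

(** The adjacency matrix [A] is symmetric with zero diagonal, so its eigenvalues
    are real and sum to zero; the energy is therefore twice the sum [s] of the
    nonnegative eigenvalues. If [c A] has integer entries, then [c s] is an
    algebraic integer, hence an integer as soon as the energy is rational. One
    may take [c = 1] when there is no middle end vertex, and [c = 4] always. *)

(** * Algebraic integers and rationality *)

Section Integrality.

(** Transfers the question to [algC], where a rational algebraic integer is known to be an
    integer. *)
Lemma integral_rat_int (q : rat) :
  integralOver (intr : int -> rat) q -> exists m : int, q = m%:~R.
Proof.
move=> [p p_monic pq0].
have /Cint_rat_Aint : (ratr q : algC) \in Crat by apply: Crat_rat.
suff qA : (ratr q : algC) \in Aint.
  by move=> /(_ qA) /intrP[m qm]; exists m; apply: (fmorph_inj (@ratr algC));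
    rewrite /= qm rmorph_int.
apply: (@root_monic_Aint (map_poly intr p)); last 2 first.
- exact: monic_map.
- by apply/polyOverP => i; rewrite coef_map /= intr_int.
have -> : map_poly intr p = map_poly (@ratr algC) (map_poly intr p).
  by rewrite -map_poly_comp; apply: eq_map_poly => i /=; rewrite rmorph_int.
by rewrite fmorph_root.
Qed.

(** A monic integer polynomial vanishing at [ratr q] already vanishes at [q], since [ratr] is an
    injective morphism. *)
Lemma integral_ratr_int (F : numFieldType) (q : rat) :
  integralOver (intr : int -> F) (ratr q) -> exists m : int, q = m%:~R.
Proof.
move=> [p p_monic pq0]; apply: integral_rat_int; exists p => //.
rewrite -(fmorph_root (@ratr F)) -map_poly_comp.
by rewrite (@eq_map_poly _ _ _ intr) // => i /=; rewrite rmorph_int.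
Qed.

Lemma integral_sum (K : fieldType) (I : eqType) (r : seq I) (P : pred I)
    (F : I -> K) :
  (forall i, i \in r -> P i -> integralOver (intr : int -> K) (F i)) ->
  integralOver (intr : int -> K) (\sum_(i <- r | P i) F i).
Proof.
move=> intF; rewrite big_seq_cond.
apply: big_rec => [|i x /andP[ri Pi]]; first exact: integral0.
exact/integral_add/intF.
Qed.

(** The characteristic polynomial of [M] is monic with integer coefficients. *)
Lemma integral_eigenvalue (K : fieldType) n (M : 'M[int]_n) (z : K) :
  eigenvalue (map_mx intr M) z -> integralOver (intr : int -> K) z.
Proof.
rewrite eigenvalue_root_char -map_char_poly => Mz.
by exists (char_poly M); rewrite ?char_poly_monic.
Qed.

Lemma eigenvalue_scale (K : fieldType) n (A : 'M[K]_n) (c z : K) :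
  eigenvalue A z -> eigenvalue (c *: A) (c * z).
Proof.
move=> /eigenvalueP[v vA v0]; apply/eigenvalueP; exists v => //.
by rewrite -scalemxAr vA scalerA.
Qed.

End Integrality.

(** * Eigenvalues of a real symmetric matrix of trace zero *)

Section Spectrum.
Variables (R : rcfType) (n : nat) (A : 'M[R]_n).
Local Notation AC := (map_mx (real_complex R) A).

Lemma char_poly_eigenvalues :
  char_poly AC = \prod_(z <- eigenvalues A) ('X - z%:P).
Proof.
rewrite /eigenvalues; case: closed_field_poly_normal => r /= {1}->.
by rewrite (monicP (char_poly_monic _)) scale1r.
Qed.

Lemma eigenvalues_eigenvalue z : z \in eigenvalues A -> eigenvalue AC z.
Proof.
by move=> zA; rewrite eigenvalue_root_char char_poly_eigenvalues root_prod_XsubC.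
Qed.

Lemma sum_eigenvalues : (0 < n)%N -> \sum_(z <- eigenvalues A) z = \tr AC.
Proof.
move=> n_gt0; have := char_poly_trace AC n_gt0.
have sz : size (eigenvalues A) = n.
  have := size_char_poly AC.
  by rewrite char_poly_eigenvalues size_prod_XsubC => -[].
(* With [n] read as the number of roots, the coefficient of degree [n.-1] is minus the sum of the
   roots. *)
rewrite char_poly_eigenvalues -[X in X.-1]sz coefPn_prod_XsubC ?sz -?lt0n //.
by move=> /oppr_inj.
Qed.

(** For an eigenvector [v] with conjugate transpose [w], the only entry of [v *m AC *m w] is
    [z * s], where [s] is the squared norm of [v]. As [AC] is real and symmetric, this entry is its
    own conjugate; dividing by the positive real [s] shows that [z] is its own conjugate. *)
Lemma symmetric_eigenvalue_real z :
  A^T = A -> eigenvalue AC z -> z \is Num.real.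
Proof.
move=> symA /eigenvalueP[v vA v0].
pose w := (map_mx conjc v)^T; pose s := (v *m w) 0 0.
have s_gt0 : 0 < s.
  have sE : s = \sum_j `|v 0 j| ^+ 2.
    by rewrite /s mxE; apply: eq_bigr => j _; rewrite !mxE sqr_normc.
  rewrite lt0r sE sumr_ge0 ?andbT => [|j _]; last by rewrite exprn_ge0.
  apply: contra v0; rewrite psumr_eq0 => [/allP v_eq0|j _]; last first.
    by rewrite exprn_ge0.
  apply/eqP/rowP => j; rewrite mxE.
  by have := v_eq0 j (mem_index_enum j); rewrite expf_eq0 normr_eq0 /= => /eqP.
have ACconj : map_mx conjc AC = AC.
  by apply/matrixP => i j; rewrite !mxE conjc_real.
have vconj : map_mx conjc (map_mx conjc v) = v.
  by apply/matrixP => i j; rewrite !mxE conjcK.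
have conjvAw : map_mx conjc (v *m AC *m w) = (v *m AC *m w)^T.
  have ACT : AC^T = AC by rewrite map_trmx symA.
  have wconj : map_mx conjc w = v^T by rewrite /w -map_trmx vconj.
  by rewrite !map_mxM ACconj wconj !trmx_mul ACT trmxK mulmxA.
have zs : (v *m AC *m w) 0 0 = z * s by rewrite vA -scalemxAl mxE.
have := congr1 (fun M : 'M_1 => M 0 0) conjvAw.
have -> : ((v *m AC *m w)^T) 0 0 = (v *m AC *m w) 0 0 by rewrite mxE.
rewrite mxE zs rmorphM /= => zszs.
have sJ : s^*%C = s by rewrite -(RRe_real (gtr0_real s_gt0)) conjc_real.
move: zszs; rewrite sJ => /(mulIf (lt0r_neq0 s_gt0)).
case: z {vA zs} => a b /= [/eqP]; rewrite complex_real.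
by rewrite eqNr.
Qed.

(* A zero trace makes the negative eigenvalues contribute as much to the sum of
   absolute values as the positive ones. *)
Lemma sum_norm_eigenvalues : (0 < n)%N -> A^T = A -> \tr A = 0 ->
  (\sum_(z <- eigenvalues A) complex.Re `|z|)%:C%C
    = 2 * \sum_(z <- eigenvalues A | 0 <= z) z.
Proof.
move=> n_gt0 symA trA.
have tr0 : \sum_(z <- eigenvalues A) z = 0.
  by rewrite sum_eigenvalues // trace_map_mx trA rmorph0.
have posE : \sum_(z <- eigenvalues A | 0 <= z) z
    = \sum_(z <- eigenvalues A | ~~ (0 <= z)) - z.
  apply/eqP; rewrite sumrN -addr_eq0; apply/eqP; rewrite -[RHS]tr0.
  by rewrite [RHS](bigID (fun z => 0 <= z)).
rewrite rmorph_sum mulr_natl mulr2n [X in _ + X]posE.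
rewrite (bigID (fun z => 0 <= z)) /=.
congr (_ + _); rewrite big_seq_cond [RHS]big_seq_cond; apply: eq_bigr => z /andP[zA z0].
  by rewrite (RRe_real (normr_real z)) ger0_norm.
rewrite (RRe_real (normr_real z)) ler0_norm //.
(* In the partial order of [R[i]], the failure of [0 <= z] yields [z <= 0] only because [z] is
   real. *)
have := symmetric_eigenvalue_real symA (eigenvalues_eigenvalue zA).
by rewrite realE (negbTE z0).
Qed.

(** [c * q / 2] is the sum of [c * z] over the nonnegative eigenvalues [z]. Each [c * z] is an
    eigenvalue of the integer matrix [M], so this rational number is an algebraic integer, hence the
    integer [m]. *)
Lemma sum_norm_eigenvalues_int (c : nat) (M : 'M[int]_n) (q : rat) :
    (0 < n)%N -> (0 < c)%N -> A^T = A -> \tr A = 0 ->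
    c%:R *: A = map_mx intr M ->
    \sum_(z <- eigenvalues A) complex.Re `|z| = ratr q ->
  exists m : int, \sum_(z <- eigenvalues A) complex.Re `|z| = (2 * m)%:~R / c%:R.
Proof.
move=> n_gt0 c_gt0 symA trA cA Eq.
have c_neq0 : c%:R != 0 :> R by rewrite pnatr_eq0 -lt0n.
have two_neq0 : 2 != 0 :> R[i] by rewrite pnatr_eq0.
have : integralOver (intr : int -> R[i]) (ratr (c%:R * q / 2)).
  have -> : ratr (c%:R * q / 2) = \sum_(z <- eigenvalues A | 0 <= z) c%:R * z.
    rewrite fmorph_div rmorphM /= !ratr_nat -mulr_sumr.
    have -> : ratr q = (ratr q : R)%:C%C by rewrite fmorph_rat.
    by rewrite -Eq sum_norm_eigenvalues // mulrCA mulrAC divff // mul1r.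
  apply: integral_sum => z /eigenvalues_eigenvalue zA _.
  apply: (@integral_eigenvalue _ _ M).
  have -> : map_mx intr M = c%:R *: AC.
    rewrite -(rmorph_nat (real_complex R)) -map_mxZ cA -map_mx_comp.
    by apply: eq_map_mx => i /=; rewrite rmorph_int.
  exact: eigenvalue_scale.
move=> /integral_ratr_int[m mE]; exists m; rewrite Eq.
apply: (mulIf c_neq0); rewrite divfK // intrM -(ratr_int _ m) -mE.
rewrite fmorph_div rmorphM /= !ratr_nat mulrC.
by rewrite [RHS]mulrC divfK // pnatr_eq0.
Qed.

End Spectrum.

(** * Symmetry, trace and denominators of the adjacency matrix *)

Section Adjacency.
Variables (n : nat) (G : semigraph n) (R : fieldType).

Lemma edge_distC (e : seq 'I_n) u v : edge_dist e u v = edge_dist e v u.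
Proof. exact: distnC. Qed.

Lemma is_partial_halfC u v : is_partial_half G u v = is_partial_half G v u.
Proof. by apply: eq_has => e; rewrite orbC. Qed.

Lemma is_quarterC u v : is_quarter G u v = is_quarter G v u.
Proof. by apply: eq_has => e; rewrite eq_sym [(u \in e) && _]andbCA. Qed.

Lemma full_or_half_edgesC u v :
  full_or_half_edges G u v = full_or_half_edges G v u.
Proof. by apply: eq_filter => e; rewrite [(u \in e) && _]andbC. Qed.

Lemma adjacency_sym : (adjacency G R)^T = adjacency G R.
Proof.
apply/matrixP => i j; rewrite !mxE is_partial_halfC is_quarterC.
rewrite full_or_half_edgesC; do 2 case: ifP => // _.
by case: full_or_half_edges => // e _; rewrite edge_distC.
Qed.

Lemma edge_distxx (e : seq 'I_n) v : edge_dist e v v = 0%N.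
Proof. exact: distnn. Qed.

Lemma adjacency_diag v : adjacency G R v v = 0.
Proof.
rewrite mxE ifN; last first.
  by apply/hasPn => e _; rewrite /partial_half_from edge_distxx !andbF.
rewrite ifN; last by apply/hasPn => e _; rewrite eqxx !andbF.
by case: full_or_half_edges => // e _; rewrite edge_distxx.
Qed.

Lemma adjacency_trace : \tr (adjacency G R) = 0.
Proof. by rewrite /mxtrace big1 // => i _; rewrite adjacency_diag. Qed.

Lemma no_middle_end_partial_half u v :
  (forall w, ~~ middle_end G w) -> is_partial_half G u v = false.
Proof.
move=> nomid; apply/negbTE/hasPn => e _.
by rewrite /partial_half_from !(negbTE (nomid _)) !andbF.
Qed.

Lemma no_middle_end_quarter u v :
  (forall w, ~~ middle_end G w) -> is_quarter G u v = false.
Proof.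
move=> nomid; apply/negbTE/hasPn => e /edge_size; case: e => // w e _.
rewrite /quarter_edge; apply/negP => /and4P[/andP[_ /forallP/(_ w)]].
(* The head [w] of a quarter edge is an end vertex, so it would be a middle end vertex. *)
by rewrite (negbTE (nomid w)) implybF /end_of mem_head /= eqxx.
Qed.

Lemma adjacency_int : (forall w, ~~ middle_end G w) ->
  exists M : 'M[int]_n, adjacency G R = map_mx intr M.
Proof.
move=> nomid.
exists (\matrix_(i, j)
  if full_or_half_edges G i j is e :: _ then (edge_dist e i j)%:Z else 0).
apply/matrixP => i j.
rewrite !mxE no_middle_end_partial_half // no_middle_end_quarter //.
by case: full_or_half_edges.
Qed.

(** Multiplication by 4 turns the entries 1/2, 1/4 and [d] into 2, 1 and [4 * d]; the first two need
    2 to be invertible in [R]. *)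
Lemma adjacency_quarter_int : 2 != 0 :> R ->
  exists M : 'M[int]_n, 4 *: adjacency G R = map_mx intr M.
Proof.
move=> two_neq0.
have four : 4 = 2 * 2 :> R by rewrite -natrM.
exists (\matrix_(i, j)
  if is_partial_half G i j then 2
  else if is_quarter G i j then 1
  else if full_or_half_edges G i j is e :: _
  then 4 * (edge_dist e i j)%:Z else 0).
apply/matrixP => i j; rewrite !mxE.
case: ifP => _; first by rewrite four mulfK.
case: ifP => _; first by rewrite divff // four mulf_neq0.
by case: full_or_half_edges => [|e _]; rewrite ?mulr0 // intrM.
Qed.

End Adjacency.

Theorem theorem1 (R : realType) (n : nat) (hn : (2 <= n)%N) (G : semigraph n)
    (Gconn : sg_connected G)
    (Erat : exists q : rat, energy R G = ratr q) :
  ((forall v, ~~ middle_end G v) ->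
     exists m : int, energy R G = (2 * m)%:~R)
  /\ ((exists v, middle_end G v) ->
     exists (N : int) (r : nat), energy R G = N%:~R / 2 ^+ r).
Proof.
have n_gt0 : (0 < n)%N by apply: leq_trans hn.
have [q Eq] := Erat.
have energy_int c M c_gt0 cA := @sum_norm_eigenvalues_int _ _ _ c M q n_gt0
  c_gt0 (adjacency_sym G R) (adjacency_trace G R) cA Eq.
split=> [nomid | _].
  have [M AM] := adjacency_int R nomid.
  have [||m Em] := energy_int 1%N M; rewrite ?scale1r //.
  by exists m; rewrite /energy Em divr1.
have [|M AM] := @adjacency_quarter_int _ G R; first by rewrite pnatr_eq0.
have [//||m Em] := energy_int 4%N M; first exact: AM.
(* The energy is [2 * m / 4], and 4 is [2 ^+ 2]. *)
by exists (2 * m), 2%N; rewrite /energy Em -natrX.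
Qed.
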